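(* Let $k$ be a field with $u(k)\leq 2$ which is not quadratically closed, with $\mathrm{char}(k)\neq 2$ and $|k|>5$. Let $\mathscr{C}$ be a conjugacy class in $\mathrm{SL}_2(k)$. Then, for $\overline{\epsilon}\in k^{\times}/k^{\times 2}$, $\mathscr{C}\subseteq U_{\overline{\epsilon}}^2$ if and only if one of the following holds: (1) $\mathscr{C}$ is a semisimple conjugacy class with $2-\mathrm{tr}(\mathscr{C})\in k^{\times 2}$; (2) $\mathscr{C}$ is a unipotent conjugacy class; (3) $\mathscr{C}=U_{-1,\overline{\epsilon}}$; (4) $\mathscr{C}=\{I\}$ and $-1\in k^{\times 2}$.
   Context: A field $k$ has $u(k)\leq 2$ if every quadratic form in $3$ variables over $k$ is isotropic. A field is quadratically closed if it admits no quadratic extension. $k^{\times 2}$ is the set of squares in $k^\times$, and $\bar\epsilon$ is the image of $\epsilon\in k^\times$ in $k^\times/k^{\times2}$. $U_{\overline{\epsilon}}$ denotes the $\mathrm{SL}_2(k)$-conjugacy class of $\begin{pmatrix}1&\epsilon\\0&1\end{pmatrix}$ and $U_{-1,\overline{\epsilon}}$ that of $\begin{pmatrix}-1&\epsilon\\0&-1\end{pmatrix}$; both depend only on $\overline{\epsilon}$. The unipotent conjugacy classes are exactly the $U_{\overline{\epsilon}}$ (so $\{I\}$ is not counted as unipotent). Semisimple classes are non-central. $\mathrm{tr}(\mathscr{C})$ is the common trace of elements of $\mathscr{C}$, and $U_{\overline{\epsilon}}^2=\{xy:x,y\in U_{\overline{\epsilon}}\}$. *)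

(* Defs.v *)
From HB Require Import structures.
From mathcomp Require Import all_boot all_order all_algebra all_field.
From mathcomp Require Import boolp classical_sets.
From mathcomp Require Import ring.

Set Implicit Arguments.
Unset Strict Implicit.
Unset Printing Implicit Defensive.

Import GRing.Theory.
Local Open Scope classical_set_scope.
Local Open Scope ring_scope.

(* [a] lists the coefficients; [a] need not be symmetric, so every homogeneous
   polynomial of degree 2 is covered, degenerate forms included. *)
Definition quad_form (k : fieldType) n (a : 'M[k]_n) (v : 'rV[k]_n) : k :=
  \sum_(i < n) \sum_(j < n) a i j * v 0 i * v 0 j.

Definition isotropic (k : fieldType) n (a : 'M[k]_n) : Prop :=
  exists2 v : 'rV[k]_n, v != 0 & quad_form a v = 0.

Definition u_le2 (k : fieldType) : Prop := forall a : 'M[k]_3, isotropic a.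

Definition quadratically_closed (k : fieldType) : Prop :=
  ~ exists L : fieldExtType k, \dim {: L} = 2%N.

Definition squares (k : fieldType) : set k :=
  [set a | exists2 c, c != 0 & a = c ^+ 2].

Definition SL2 (k : fieldType) : set 'M[k]_2 := [set x | \det x = 1].

Definition sl2_class (k : fieldType) (x : 'M[k]_2) : set 'M[k]_2 :=
  [set g * x * g^-1 | g in @SL2 k].

Definition is_sl2_class (k : fieldType) (C : set 'M[k]_2) : Prop :=
  exists2 x, SL2 x & C = sl2_class x.

Definition mx2 (k : fieldType) (a b c d : k) : 'M[k]_2 :=
  \matrix_(i, j) if i == 0 then (if j == 0 then a else b)
                 else (if j == 0 then c else d).

(* The classes indexed by a square class are given through a representative
   [e != 0]; see [Uclass_sq] and [Umclass_sq]. *)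
Definition Uclass (k : fieldType) (e : k) : set 'M[k]_2 :=
  sl2_class (mx2 1 e 0 1).

Definition Umclass (k : fieldType) (e : k) : set 'M[k]_2 :=
  sl2_class (mx2 (-1) e 0 (-1)).

Definition mulset (k : fieldType) (A B : set 'M[k]_2) : set 'M[k]_2 :=
  [set x * y | x in A & y in B].

(* The value on a class does not depend on the element chosen by [xget]:
   see [class_trE]. *)
Definition class_tr (k : fieldType) (C : set 'M[k]_2) : k := \tr (xget 0 C).

(* A matrix over k is diagonalizable over an algebraic closure of k iff it is
   so over some finite extension of k. *)
Definition semisimple (k : fieldType) (x : 'M[k]_2) : Prop :=
  exists L : fieldExtType k, diagonalizable (map_mx (in_alg L) x).

Definition central (k : fieldType) (x : 'M[k]_2) : Prop :=
  forall g, SL2 g -> g * x = x * g.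

Definition semisimple_class (k : fieldType) (C : set 'M[k]_2) : Prop :=
  exists x, [/\ SL2 x, semisimple x, ~ central x & C = sl2_class x].

Definition unipotent (k : fieldType) (x : 'M[k]_2) : Prop :=
  exists n, (x - 1) ^+ n = 0.

Definition unipotent_class (k : fieldType) (C : set 'M[k]_2) : Prop :=
  exists x, [/\ SL2 x, unipotent x, x <> 1 & C = sl2_class x].

Section Theory.
Variable k : fieldType.
Implicit Types (a b c d e : k) (x g h : 'M[k]_2) (C : set 'M[k]_2).

Lemma ord2P (i : 'I_2) : i = 0 \/ i = 1.
Proof. by case: i => [[|[|//]] ?]; [left|right]; apply: val_inj. Qed.

Lemma det2E x : \det x = x 0 0 * x 1 1 - x 0 1 * x 1 0.
Proof.
rewrite (expand_det_row _ 0) !big_ord_recl big_ord0 /cofactor !det_mx11 !mxE /=.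
rewrite !(expr0, expr1, mul1r, mulN1r, addr0, mulrN).
by congr (x _ _ * x _ _ - x _ _ * x _ _); apply: val_inj.
Qed.

Lemma mx2_eta x : x = mx2 (x 0 0) (x 0 1) (x 1 0) (x 1 1).
Proof.
apply/matrixP => i j; rewrite !mxE.
by case: (ord2P i) => ->; case: (ord2P j) => ->.
Qed.

Lemma mul_mx2 a b c d a' b' c' d' :
  mx2 a b c d * mx2 a' b' c' d' =
  mx2 (a * a' + b * c') (a * b' + b * d') (c * a' + d * c') (c * b' + d * d').
Proof.
apply/matrixP => i j; rewrite !mxE !big_ord_recl big_ord0 !mxE /= addr0.
by case: (ord2P i) => ->; case: (ord2P j) => ->.
Qed.

Lemma det_mx2E a b c d : \det (mx2 a b c d) = a * d - b * c.
Proof. by rewrite det2E !mxE. Qed.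

Lemma SL2_unit g : SL2 g -> g \is a GRing.unit.
Proof. by move=> dg; rewrite unitmxE dg unitr1. Qed.

Lemma SL2_mul g h : SL2 g -> SL2 h -> SL2 (g * h).
Proof. by rewrite /SL2 /= -mulmxE det_mulmx => -> ->; rewrite mulr1. Qed.

Lemma SL2_inv g : SL2 g -> SL2 g^-1.
Proof. by rewrite /SL2 /= det_inv => ->; rewrite invr1. Qed.

Lemma sl2_class_refl x : sl2_class x x.
Proof. by exists 1; rewrite ?invr1 ?mulr1 ?mul1r //= /SL2 /= det1. Qed.

Lemma sl2_class_eq x y : sl2_class x y -> sl2_class y = sl2_class x.
Proof.
move=> [g dg <-]; have ug := SL2_unit dg.
apply/seteqP; split => _ [h dh <-].
  exists (h * g); first exact: SL2_mul.
  by rewrite invrM ?SL2_unit // !mulrA.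
exists (h * g^-1); first exact: SL2_mul (SL2_inv _).
by rewrite invrM ?unitrV ?SL2_unit // invrK !mulrA !mulrVK // -?mulrA.
Qed.

Lemma sl2_class_intertwine x y g :
  SL2 g -> g * x = y * g -> sl2_class y = sl2_class x.
Proof.
move=> dg E; apply: sl2_class_eq; exists g => //.
by rewrite E mulrK // SL2_unit.
Qed.

Lemma class_trE C x : is_sl2_class C -> C x -> class_tr C = \tr x.
Proof.
move=> [y _ ->] xC.
have trC z : sl2_class y z -> \tr z = \tr y.
  by move=> [g dg <-]; rewrite -!mulmxE mxtrace_mulC mulmxE mulrA mulVr ?mul1r ?SL2_unit.
by rewrite (trC _ xC) /class_tr trC //; apply: xgetI xC.
Qed.

Lemma upper_class_sq a e c :
  c != 0 -> sl2_class (mx2 a (e * c ^+ 2) 0 a) = sl2_class (mx2 a e 0 a).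
Proof.
move=> c0; apply: (@sl2_class_intertwine _ _ (mx2 c 0 0 c^-1)).
  by rewrite /SL2 /= det_mx2E mulfV // mul0r subr0.
by rewrite !mul_mx2; congr mx2; field.
Qed.

Lemma Uclass_sq e c : c != 0 -> Uclass (e * c ^+ 2) = Uclass e.
Proof. exact: upper_class_sq. Qed.

Lemma Umclass_sq e c : c != 0 -> Umclass (e * c ^+ 2) = Umclass e.
Proof. exact: upper_class_sq. Qed.

Lemma unipotent_classP C :
  unipotent_class C <-> exists2 e, e != 0 & C = Uclass e.
Proof.
have one2 : 1 = mx2 1 0 0 1 :> 'M[k]_2.
  by apply/matrixP => i j; rewrite !mxE; case: (ord2P i) => ->; case: (ord2P j) => ->.
split=> [[x [dx [n xn] x1 ->]]|[e e0 ->]]; last first.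
  exists (mx2 1 e 0 1); split=> //.
  - by rewrite /SL2 /= det_mx2E mulr1 mulr0 subr0.
  - exists 2%N; rewrite expr2.
    have -> : mx2 1 e 0 1 - 1 = mx2 0 e 0 0.
      by rewrite [in LHS]one2; apply/matrixP => i j; rewrite !mxE;
         case: (ord2P i) => ->; case: (ord2P j) => -> /=; rewrite ?subrr ?subr0.
    rewrite mul_mx2 !(mulr0, mul0r, addr0); apply/matrixP => i j.
    by rewrite !mxE; case: ifP; case: ifP.
  - by move=> /matrixP /(_ 0 1); rewrite !mxE /= => /eqP; rewrite (negPf e0).
have dN : \det (x - 1) = 0.
  apply/eqP; apply: contraT => dN; have : (x - 1) \is a GRing.unit by rewrite unitmxE unitfE.
  by move=> /(unitrX n); rewrite xn unitr0.
move: dx dN x1; rewrite /SL2 /= !det2E !mxE /= (mx2_eta x).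
move: (x 0 0) (x 0 1) (x 1 0) (x 1 1) => a b c d dx dN x1; rewrite !mxE /= in dx dN.
have Ed : d = 2 - a.
  have : a + d - 2 = (a * d - b * c) - ((a - 1) * (d - 1) - (b - 0) * (c - 0)) - 1 by ring.
  by rewrite dx dN subr0 subrr => E; apply/eqP; rewrite -subr_eq0 -[0]E; apply/eqP; ring.
have Ebc : b * c = - (a - 1) ^+ 2.
  apply/eqP; rewrite -subr_eq0 -oppr_eq0 -[X in _ == X]dN Ed; apply/eqP; ring.
have [c0|c0] := eqVneq c 0.
  have a1 : a = 1.
    move: Ebc; rewrite c0 mulr0 => /esym/eqP.
    by rewrite oppr_eq0 expf_eq0 /= subr_eq0 => /eqP.
  have d1 : d = 1 by rewrite Ed a1; ring.
  exists b; last by rewrite c0 a1 d1.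
  by apply: contra_notN x1 => /eqP ->; rewrite c0 a1 d1 one2.
exists (- c); first by rewrite oppr_eq0.
have Eb : b = - (a - 1) ^+ 2 / c by rewrite -Ebc mulfK.
apply: (@sl2_class_intertwine _ _ (mx2 ((a - 1) / c) (-1) 1 0)).
  by rewrite /SL2 /= det_mx2E; ring.
by rewrite !mul_mx2 Eb Ed; congr mx2; field.
Qed.

End Theory.

(* Main.v *)
Require Import Defs.
From HB Require Import structures.
From mathcomp Require Import all_boot all_order all_algebra all_field.
From mathcomp Require Import boolp classical_sets.
From mathcomp Require Import ring.

Set Implicit Arguments.
Unset Strict Implicit.
Unset Printing Implicit Defensive.

Import GRing.Theory.
Local Open Scope classical_set_scope.
Local Open Scope ring_scope.

(** The elements of U_e are the matrices 1 + e v v^J with v <> 0, where v^J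
    is the row vector such that v^J w = det(v, w).  A product of two of them,
    for v and w, has trace 2 - (e det(v, w))^2.  If det(v, w) = 0 the product
    is 1 + e (1 + l^2) v v^J with w = l v, and 1 + l^2 takes every square class
    because binary quadratic forms are universal.  If det(v, w) <> 0, the class
    of a matrix M of SL_2 is determined by its trace and one nonzero value of
    the binary form Q_M(v) = det(v, M v), whose discriminant is tr(M)^2 - 4; by
    universality the trace alone suffices when it is not 2 or -2. *)

(** * Universality of binary quadratic forms, and sums of two nonzero squares *)

Section Forms.
Variable k : fieldType.
Hypothesis hu : u_le2 k.

(** Take an isotropic vector (x, y, z) of the ternary form obtained by adding - q z^2. If z is
    nonzero, divide by it; otherwise (x, y) is isotropic for a nondegenerate binary form, which is
    then a hyperbolic plane. *)
Lemma binary_universal (a b c q : k) :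
  b ^+ 2 - 4 * a * c != 0 ->
  exists x y, a * x ^+ 2 + b * x * y + c * y ^+ 2 = q.
Proof.
move=> disc.
pose A : 'M[k]_3 := \matrix_(i, j)
  nth 0 (nth [::] [:: [:: a; b; 0]; [:: 0; c; 0]; [:: 0; 0; - q]] i) j.
have [v v0] := hu A.
rewrite /quad_form !big_ord_recl !big_ord0 !mxE /=.
have vE : v = \row_i nth 0 [:: v 0 0; v 0 (lift ord0 ord0);
                              v 0 (lift ord0 (lift ord0 ord0))] i.
  apply/rowP => i; rewrite mxE.
  by case: i => [[|[|[|//]]] ?] /=; congr (v _ _); apply: val_inj.
move: vE v0; move: (v 0 0) (v 0 (lift _ _)) (v 0 (lift _ (lift _ _))).
move=> x y z -> v0 E.
have {}E : a * x ^+ 2 + b * x * y + c * y ^+ 2 = q * z ^+ 2.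
  by apply/eqP; rewrite -subr_eq0 -[X in _ == X]E; apply/eqP; ring.
have [z0|z0] := eqVneq z 0; last first.
  exists (x / z), (y / z); apply: (mulIf (expf_neq0 2 z0)).
  by rewrite -E; field.
move: E; rewrite z0 expr0n mulr0 => E.
have [Bx|Bx] := eqVneq (2 * a * x + b * y) 0; last first.
  (* On the line (1, 0) + l (x, y) the form is affine in l, with slope the polar form of (x, y) and
     (1, 0); solve for l. *)
  exists ((q - a) / (2 * a * x + b * y) * x + 1),
         ((q - a) / (2 * a * x + b * y) * y).
  set l := _ / _.
  have -> : a * (l * x + 1) ^+ 2 + b * (l * x + 1) * (l * y) + c * (l * y) ^+ 2
    = l ^+ 2 * (a * x ^+ 2 + b * x * y + c * y ^+ 2)
      + l * (2 * a * x + b * y) + a by ring.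
  by rewrite E mulr0 add0r divfK // subrK.
have [By|By] := eqVneq (b * x + 2 * c * y) 0; last first.
  exists ((q - c) / (b * x + 2 * c * y) * x),
         ((q - c) / (b * x + 2 * c * y) * y + 1).
  set l := _ / _.
  have -> : a * (l * x) ^+ 2 + b * (l * x) * (l * y + 1) + c * (l * y + 1) ^+ 2
    = l ^+ 2 * (a * x ^+ 2 + b * x * y + c * y ^+ 2)
      + l * (b * x + 2 * c * y) + c by ring.
  by rewrite E mulr0 add0r divfK // subrK.
(* Here (x, y) is orthogonal to both basis vectors, so the nonzero discriminant forces it to
   vanish. *)
case/eqP: v0; have x0 : x = 0.
  apply: (mulfI disc); rewrite mulr0.
  have -> : (b ^+ 2 - 4 * a * c) * x
    = b * (b * x + 2 * c * y) - 2 * c * (2 * a * x + b * y) by ring.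
  by rewrite Bx By !mulr0 subrr.
have y0 : y = 0.
  apply: (mulfI disc); rewrite mulr0.
  have -> : (b ^+ 2 - 4 * a * c) * y
    = b * (2 * a * x + b * y) - 2 * a * (b * x + 2 * c * y) by ring.
  by rewrite Bx By !mulr0 subrr.
rewrite x0 y0 z0; apply/rowP => i; rewrite !mxE.
by case: i => [[|[|[|//]]] ?].
Qed.

Hypothesis two0 : (2 : k) != 0.

Lemma four_neq0 : (4 : k) != 0.
Proof. by rewrite (_ : 4 = 2 * 2) ?mulf_neq0 // -natrM. Qed.

(** If [f] is not a square, no representation by x^2 + y^2 has a zero coordinate. If f = c^2, scale
    a rational point of the unit circle with parameter t; its coordinates are defined and nonzero
    when t (1 - t^2) (1 + t^2) is nonzero. *)
Lemma sum_nz_squares (s : seq k) (f : k) : uniq s -> (5 < size s)%N -> f != 0 ->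
  exists x y, [/\ x != 0, y != 0 & x ^+ 2 + y ^+ 2 = f].
Proof.
move=> us ss f0.
have [|x0 [y0]] := @binary_universal 1 0 1 f.
  by rewrite expr0n sub0r !mulr1 oppr_eq0 four_neq0.
rewrite !(mul1r, mul0r) addr0 => E0.
have [[c [c0 fc]]|nsq] := pselect (exists c, c != 0 /\ f = c ^+ 2); last first.
  exists x0, y0; split=> //; apply/negP => /eqP z0; apply: nsq.
  - exists y0; move: E0; rewrite z0 expr0n add0r => E; split=> //.
    by apply: contraNneq f0 => y00; rewrite -E y00 expr0n.
  - exists x0; move: E0; rewrite z0 expr0n addr0 => E; split=> //.
    by apply: contraNneq f0 => x00; rewrite -E x00 expr0n.
(* The bad parameters are the roots of X^5 - X, at most five in number. *)
have : ~~ all (root ('X^5 - 'X)) s.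
  have sz : size ('X^5 - 'X : {poly k}) = 6.
    by rewrite size_polyDl size_polyXn // size_polyN size_polyX.
  have p0 : 'X^5 - 'X != 0 :> {poly k} by rewrite -size_poly_eq0 sz.
  by apply/negP => /(max_poly_roots p0)/(_ us); rewrite sz ltnNge ss.
case/allPn => t _; rewrite rootE !hornerE => tn.
have E : t ^+ 5 - t = t * ((1 - t ^+ 2) * - (1 + t ^+ 2)) by ring.
move: tn; rewrite E !mulf_eq0 !negb_or oppr_eq0 => /and3P[t0 t1 t2].
exists (c * ((1 - t ^+ 2) / (1 + t ^+ 2))), (c * (2 * t / (1 + t ^+ 2))).
by split; rewrite ?fc ?mulf_neq0 ?invr_eq0 //; field.
Qed.

End Forms.

(** * Conjugacy classes of SL_2 and products of two elements of U_e *)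

Section Classes.
Variable k : fieldType.
Implicit Types (a b c d e f q s t x y : k) (M g : 'M[k]_2) (C : set 'M[k]_2).

Lemma one_mx2 : 1 = mx2 1 0 0 1 :> 'M[k]_2.
Proof.
by apply/matrixP => i j; rewrite !mxE; case: (ord2P i) => ->; case: (ord2P j) => ->.
Qed.

Lemma mx2_inj a b c d a' b' c' d' : mx2 a b c d = mx2 a' b' c' d' ->
  [/\ a = a', b = b', c = c' & d = d'].
Proof.
move/matrixP=> E.
by split; [have := E 0 0|have := E 0 1|have := E 1 0|have := E 1 1]; rewrite !mxE.
Qed.

Lemma trace_mx2 a b c d : \tr (mx2 a b c d) = a + d.
Proof. by rewrite /mxtrace !big_ord_recl big_ord0 !mxE /= addr0. Qed.

Lemma is_sl2_class_class M : SL2 M -> is_sl2_class (sl2_class M).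
Proof. by exists M. Qed.

Lemma sl2_class1 : sl2_class 1 = [set (1 : 'M[k]_2)].
Proof.
apply/seteqP; split => [_ [g dg <-]|_ ->]; last exact: sl2_class_refl.
by rewrite /= mulr1 divrr ?SL2_unit.
Qed.

(* The basis (v, M v / q) with v = (x, y) has determinant 1 exactly when
   q = det(v, M v), and in it M is a companion matrix. *)
Lemma sl2_class_companion a b c d x y q : a * d - b * c = 1 -> q != 0 ->
  c * x ^+ 2 + (d - a) * x * y - b * y ^+ 2 = q ->
  sl2_class (mx2 a b c d) = sl2_class (mx2 0 (- q^-1) q (a + d)).
Proof.
move=> dM q0 E.
apply: (@sl2_class_intertwine _ _ _
  (mx2 x ((a * x + b * y) / q) y ((c * x + d * y) / q))).
  rewrite /SL2 /= det_mx2E; apply: (mulIf q0); rewrite mul1r -[in RHS]E.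
  by field.
rewrite !mul_mx2; congr mx2; try by field.
(* Cayley-Hamilton, M (M v) = tr(M) M v - det(M) v, with the determinant isolated so that it can be
   replaced by 1. *)
- transitivity ((- x * (a * d - b * c) + (a + d) * (a * x + b * y)) / q).
    by rewrite dM; field.
  by field.
- transitivity ((- y * (a * d - b * c) + (a + d) * (c * x + d * y)) / q).
    by rewrite dM; field.
  by field.
Qed.

(* (1 + e v v^J) (1 + e w w^J) for v = (1, 0) and w = (0, d). *)
Definition prod_rep e d : 'M[k]_2 :=
  mx2 (1 - e ^+ 2 * d ^+ 2) e (- e * d ^+ 2) 1.

Lemma prod_rep_companion e d : e != 0 -> d != 0 ->
  sl2_class (prod_rep e d)
  = sl2_class (mx2 0 (- (- e * d ^+ 2)^-1) (- e * d ^+ 2) (2 - e ^+ 2 * d ^+ 2)).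
Proof.
move=> e0 d0; rewrite /prod_rep (@sl2_class_companion _ _ _ _ 1 0 (- e * d ^+ 2)).
- by congr (sl2_class (mx2 _ _ _ _)); ring.
- by ring.
- by rewrite mulNr oppr_eq0 mulf_neq0 ?expf_neq0.
- by ring.
Qed.

(** At trace -2 the form Q is degenerate and universality fails, but for the upper triangular
    representative it is - e y^2, which takes the required value at (0, d). *)
Lemma UmclassE e d : e != 0 -> d != 0 -> e ^+ 2 * d ^+ 2 = 4 ->
  Umclass e = sl2_class (prod_rep e d).
Proof.
move=> e0 d0 E; rewrite prod_rep_companion // /Umclass.
rewrite (@sl2_class_companion _ _ _ _ 0 d (- e * d ^+ 2)).
- by rewrite E; congr (sl2_class (mx2 _ _ _ _)); ring.
- by ring.
- by rewrite mulNr oppr_eq0 mulf_neq0 ?expf_neq0.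
- by ring.
Qed.

Lemma class_prod_rep M e d : u_le2 k -> e != 0 -> d != 0 -> SL2 M ->
  \tr M = 2 - e ^+ 2 * d ^+ 2 -> \tr M ^+ 2 != 4 ->
  sl2_class M = sl2_class (prod_rep e d).
Proof.
move=> hu e0 d0; rewrite (mx2_eta M) /SL2 /= det_mx2E trace_mx2.
move: (M 0 0) (M 0 1) (M 1 0) (M 1 1) => a b c f dM tM disc.
have [|x [y E]] := @binary_universal _ hu c (f - a) (- b) (- e * d ^+ 2).
  have -> : (f - a) ^+ 2 - 4 * c * - b = (a + f) ^+ 2 - 4 * (a * f - b * c) by ring.
  by rewrite dM mulr1 subr_eq0.
rewrite prod_rep_companion // (@sl2_class_companion _ _ _ _ x y (- e * d ^+ 2)) //.
- by rewrite tM.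
- by rewrite mulNr oppr_eq0 mulf_neq0 ?expf_neq0.
- by rewrite -E mulNr.
Qed.

(** For g in SL_2, conjugation sends 1 + e v v^J to 1 + e (g v) (g v)^J; with v = (1, 0), only the
    first column of g matters. *)
Lemma conj_upper_mx2 a b c d e : a * d - b * c = 1 ->
  mx2 a b c d * mx2 1 e 0 1 * (mx2 a b c d)^-1
  = mx2 (1 - e * a * c) (e * a ^+ 2) (- e * c ^+ 2) (1 + e * a * c).
Proof.
move=> dg; have ug : mx2 a b c d \is a GRing.unit.
  by apply: SL2_unit; rewrite /SL2 /= det_mx2E.
apply: (mulIr ug); rewrite mulrVK // !mul_mx2; congr mx2.
- by ring.
- transitivity (b + e * a * (a * d - b * c)); last by ring.
  by rewrite dg; ring.
- by ring.
- transitivity (d + e * c * (a * d - b * c)); last by ring.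
  by rewrite dg; ring.
Qed.

Lemma UclassP e M : Uclass e M <-> exists a c, (a != 0) || (c != 0) /\
  M = mx2 (1 - e * a * c) (e * a ^+ 2) (- e * c ^+ 2) (1 + e * a * c).
Proof.
split=> [[g dg <-]|[a [c [ac ->]]]].
  move: dg; rewrite /SL2 /= (mx2_eta g) det_mx2E.
  move: (g 0 0) (g 0 1) (g 1 0) (g 1 1) => a b c d dg.
  exists a, c; split; last exact: conj_upper_mx2.
  rewrite -negb_and; apply/negP => /andP[/eqP a0 /eqP c0].
  by move/eqP: dg; rewrite a0 c0 mul0r mulr0 subrr eq_sym oner_eq0.
have [b [d dg]] : exists b d, a * d - b * c = 1.
  have [a0|a0] := eqVneq a 0.
    move: ac; rewrite a0 eqxx /= => c0.
    by exists (- c^-1), 0; rewrite mulr0 mulNr mulVf // sub0r opprK.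
  by exists 0, a^-1; rewrite mulfV // mul0r subr0.
by exists (mx2 a b c d); rewrite ?conj_upper_mx2 // /SL2 /= det_mx2E.
Qed.

Lemma Uclass_conj e M g : SL2 g -> Uclass e M -> Uclass e (g * M * g^-1).
Proof.
move=> dg UM; rewrite /Uclass -(sl2_class_eq UM).
by exists g.
Qed.

Lemma mulset_class_sub e M : mulset (Uclass e) (Uclass e) M ->
  sl2_class M `<=` mulset (Uclass e) (Uclass e).
Proof.
move=> [x Ux [y Uy <-]] _ [g dg <-].
exists (g * x * g^-1); first exact: Uclass_conj.
exists (g * y * g^-1); first exact: Uclass_conj.
by rewrite !mulrA mulrVK ?SL2_unit.
Qed.

Lemma upper_mul_sub e a c : (a != 0) || (c != 0) ->
  sl2_class (mx2 1 e 0 1 *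
    mx2 (1 - e * a * c) (e * a ^+ 2) (- e * c ^+ 2) (1 + e * a * c))
  `<=` mulset (Uclass e) (Uclass e).
Proof.
move=> ac; apply: mulset_class_sub.
exists (mx2 1 e 0 1); first exact: sl2_class_refl.
exists (mx2 (1 - e * a * c) (e * a ^+ 2) (- e * c ^+ 2) (1 + e * a * c)) => //.
by apply/UclassP; exists a, c.
Qed.

Lemma prod_rep_sub e d : d != 0 ->
  sl2_class (prod_rep e d) `<=` mulset (Uclass e) (Uclass e).
Proof.
move=> d0.
have -> : prod_rep e d = mx2 1 e 0 1 *
    mx2 (1 - e * 0 * d) (e * 0 ^+ 2) (- e * d ^+ 2) (1 + e * 0 * d).
  by rewrite mul_mx2; congr mx2; ring.
by apply: upper_mul_sub; rewrite d0 orbT.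
Qed.

Lemma upper_sub e a : a != 0 ->
  sl2_class (mx2 1 (e * (1 + a ^+ 2)) 0 1) `<=` mulset (Uclass e) (Uclass e).
Proof.
move=> a0.
have -> : mx2 1 (e * (1 + a ^+ 2)) 0 1 = mx2 1 e 0 1 *
    mx2 (1 - e * a * 0) (e * a ^+ 2) (- e * 0 ^+ 2) (1 + e * a * 0).
  by rewrite mul_mx2; congr mx2; ring.
by apply: upper_mul_sub; rewrite a0.
Qed.

(** A simultaneous conjugation brings the first factor to v = (1, 0); the second one is then given
    by w = (a, c). *)
Lemma class_sub_mulset C e : is_sl2_class C ->
  C `<=` mulset (Uclass e) (Uclass e) ->
  exists a c, (a != 0) || (c != 0) /\
    C = sl2_class (mx2 (1 - e * a * c - e ^+ 2 * c ^+ 2)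
                       (e * (1 + a ^+ 2) + e ^+ 2 * a * c)
                       (- e * c ^+ 2) (1 + e * a * c)).
Proof.
move=> [M dM ->] /(_ M (sl2_class_refl M)) [_ [g dg <-] [z Uz <-]].
have ug := SL2_unit dg.
have := Uclass_conj (SL2_inv dg) Uz; rewrite invrK => /UclassP[a [c [ac E]]].
exists a, c; split=> //; apply: (@sl2_class_intertwine _ _ _ g) => //.
transitivity (g * (mx2 1 e 0 1 * (g^-1 * z * g))).
  by rewrite E mul_mx2; congr (_ * mx2 _ _ _ _); ring.
by rewrite !mulrA.
Qed.

(** Neither the trace nor the value - e c^2 of Q at (1, 0) involves [a]. *)
Lemma prod_rep_class e a c : e != 0 -> c != 0 ->
  sl2_class (mx2 (1 - e * a * c - e ^+ 2 * c ^+ 2)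
                 (e * (1 + a ^+ 2) + e ^+ 2 * a * c)
                 (- e * c ^+ 2) (1 + e * a * c))
  = sl2_class (prod_rep e c).
Proof.
move=> e0 c0; rewrite prod_rep_companion //.
rewrite (@sl2_class_companion _ _ _ _ 1 0 (- e * c ^+ 2)).
- by congr (sl2_class (mx2 _ _ _ _)); ring.
- by ring.
- by rewrite mulNr oppr_eq0 mulf_neq0 ?expf_neq0.
- by ring.
Qed.

Lemma exists_sqrt d : exists (L : fieldExtType k) (z : L), z ^+ 2 = in_alg L d.
Proof.
have [[x dx]|nsq] := pselect (exists x, x ^+ 2 = d); last first.
  have [|L _ [z]] := @irredp_FAdjoin k ('X^2 - d%:P).
    apply: cubic_irreducible => [|x]; first by rewrite size_XnsubC.
    apply/negP; rewrite rootE !hornerE subr_eq0 => /eqP E.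
    by apply: nsq; exists x.
  rewrite rmorphB /= map_polyXn map_polyC /= rootE !hornerE subr_eq0 => /eqP E _.
  by exists L, z.
(* If [d] is already a square, the trivial extension suffices. *)
by exists k^o, x; rewrite dx; apply/esym; exact: mulr1.
Qed.

Lemma sub_mx2 a b c d a' b' c' d' :
  mx2 a b c d - mx2 a' b' c' d' = mx2 (a - a') (b - b') (c - c') (d - d').
Proof. by apply/matrixP => i j; rewrite !mxE; do !case: ifP. Qed.

Lemma scalar_mx2 a : a%:M = mx2 a 0 0 a :> 'M[k]_2.
Proof.
by apply/matrixP => i j; rewrite !mxE; case: (ord2P i) => ->; case: (ord2P j) => ->.
Qed.

Lemma mx2_0 : mx2 0 0 0 0 = 0 :> 'M[k]_2.
Proof. by apply/matrixP => i j; rewrite !mxE; do !case: ifP. Qed.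

Lemma Cayley_Hamilton2 M x y : \tr M = x + y -> \det M = x * y ->
  (M - x%:M) * (M - y%:M) = 0.
Proof.
rewrite (mx2_eta M) det_mx2E trace_mx2 !scalar_mx2 !sub_mx2 mul_mx2 -mx2_0.
move: (M 0 0) (M 0 1) (M 1 0) (M 1 1) => a b c d tM dM; congr mx2.
- transitivity (a * (a + d - (x + y)) - (a * d - b * c - x * y)); first by ring.
  by rewrite tM dM !subrr mulr0 subr0.
- transitivity (b * (a + d - (x + y))); first by ring.
  by rewrite tM subrr mulr0.
- transitivity (c * (a + d - (x + y))); first by ring.
  by rewrite tM subrr mulr0.
- transitivity (d * (a + d - (x + y)) - (a * d - b * c - x * y)); first by ring.
  by rewrite tM dM !subrr mulr0 subr0.
Qed.

End Classes.

(** * Semisimplicity and centrality read off the trace *)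

Section Semisimple.
Variable k : fieldType.
Hypothesis two0 : (2 : k) != 0.
Implicit Types (M : 'M[k]_2).

(** Adjoining a square root z of the discriminant gives two distinct eigenvalues, (t + z) / 2 and (t
    - z) / 2, so the minimal polynomial has simple roots. *)
Lemma trace_semisimple M : SL2 M -> \tr M ^+ 2 != 4 -> semisimple M.
Proof.
move=> dM tM; have [L [z zE]] := exists_sqrt (\tr M ^+ 2 - 4).
exists L; apply/diagonalizableP.
have two0L : (2 : L) != 0 by rewrite -(rmorph_nat (GRing.in_alg L)) fmorph_eq0.
pose t := in_alg L (\tr M).
have zt : z ^+ 2 = t ^+ 2 - 4 by rewrite zE rmorphB rmorphXn rmorph_nat.
have z0 : z != 0 by rewrite -sqrf_eq0 zE fmorph_eq0 subr_eq0.
exists [:: (t + z) / 2; (t - z) / 2].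
  rewrite /= andbT inE; apply: contra z0 => /eqP E.
  have : z * 2 = 0.
    have -> : z * 2 = ((t + z) / 2 - (t - z) / 2) * 2 by field.
    by rewrite E subrr mul0r.
  by move/eqP; rewrite mulf_eq0 (negPf two0L) orbF.
apply: mxminpoly_min; rewrite !big_cons big_nil mulr1 rmorphM !rmorphB /=.
rewrite horner_mx_X !horner_mx_C; apply: Cayley_Hamilton2.
  by rewrite trace_map_mx -/t; field.
rewrite det_map_mx dM rmorph1.
have -> : (t + z) / 2 * ((t - z) / 2) = (t ^+ 2 - z ^+ 2) / 4.
  by field; rewrite four_neq0.
by rewrite zt opprB addrC subrK divff // four_neq0.
Qed.

Lemma central_trace M : SL2 M -> central M -> \tr M ^+ 2 = 4.
Proof.
move=> dM cM.
have E1 := cM (mx2 1 1 0 1); have E2 := cM (mx2 1 0 1 1).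
move: dM E1 E2; rewrite /SL2 /= (mx2_eta M) trace_mx2 !mul_mx2 !det_mx2E.
move: (M 0 0) (M 0 1) (M 1 0) (M 1 1) => a b c d dM.
rewrite !(mul0r, mul1r, mulr0, mulr1, addr0, add0r, subr0).
move=> /(_ erefl)/mx2_inj[ac bd _ _] /(_ erefl)/mx2_inj[ab _ _ _].
have c0 : c = 0 by apply: (addrI a); rewrite ac addr0.
have b0 : b = 0 by apply: (addrI a); rewrite -ab addr0.
have da : d = a by apply: (addrI b); rewrite bd addrC.
move: dM; rewrite da c0 mulr0 subr0 => dM.
by transitivity (4 * (a * a)); [ring|rewrite dM mulr1].
Qed.

(** The only eigenvalue is s = tr(M) / 2, so M - s is both nilpotent and diagonalizable over an
    extension, hence zero. *)
Lemma semisimple_trace_central M :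
  SL2 M -> semisimple M -> \tr M ^+ 2 = 4 -> central M.
Proof.
move=> dM [L [P uP /(similar_diagLR uP)[D ME]]] tM.
rewrite conjumx ?unitmx_inv // invmxK in ME.
pose s := \tr M / 2.
have ts : \tr M = s + s by rewrite /s; field.
have ss : \det M = s * s.
  rewrite dM /s; transitivity (\tr M ^+ 2 / 4); last by field; rewrite two0 four_neq0.
  by rewrite tM divff // four_neq0.
suff Ms : M = s%:M by move=> g _; rewrite [in RHS]Ms [in LHS]Ms; apply: scalar_mxC.
pose E := diag_mx D - (in_alg L s)%:M.
have NE : map_mx (in_alg L) (M - s%:M) = invmx P *m E *m P.
  rewrite map_mxB map_scalar_mx /= ME mulmxBr mulmxBl; congr (_ - _).
  by rewrite scalar_mxC -mulmxA mulVmx // mulmx1.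
have EE : E *m E = 0.
  have := congr1 (map_mx (in_alg L)) (Cayley_Hamilton2 ts ss).
  rewrite -mulmxE map_mxM NE map_mx0 => /(congr1 (fun X => P *m X *m invmx P)).
  by rewrite mulmx0 mul0mx !mulmxA mulmxV // mul1mx !mulmxK.
have E0 : E = 0.
  have Ediag : E = diag_mx (D - const_mx (in_alg L s)).
    by rewrite /E -diag_const_mx -raddfB.
  apply/matrixP => i j; rewrite Ediag !mxE; case: eqP => // _.
  move/matrixP/(_ i i): EE; rewrite Ediag mulmx_diag !mxE eqxx mulr1n => /eqP.
  by rewrite mulf_eq0 orbb => /eqP->.
apply/eqP; rewrite -subr_eq0 -(map_mx_eq0 (in_alg L)) NE E0.
by rewrite mulmx0 mul0mx.
Qed.

End Semisimple.

Theorem proposition3p10 (k : fieldType) (hu : u_le2 k)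
    (hq : ~ quadratically_closed k) (hchar : 2%N \notin [pchar k])
    (hcard : exists s : seq k, uniq s /\ (5 < size s)%N)
    (C : set 'M[k]_2) (hC : is_sl2_class C) (e : k) (he : e != 0) :
  C `<=` mulset (Uclass e) (Uclass e) <->
  [\/ semisimple_class C /\ squares (2 - class_tr C),
      unipotent_class C,
      C = Umclass e
    | C = [set 1] /\ squares (-1 : k)].
Proof.
have two0 : (2 : k) != 0 by move: hchar; rewrite inE /=.
split=> [/(class_sub_mulset hC)[a [c [ac EC]]]|].
  (* Parallel vectors: the product is the identity or a nontrivial unipotent element, according to
     whether 1 + a^2 vanishes. *)
  have [c0|c0] := eqVneq c 0.
    have {EC} -> : C = sl2_class (mx2 1 (e * (1 + a ^+ 2)) 0 1).
      by rewrite EC c0; congr (sl2_class (mx2 _ _ _ _)); ring.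
    have [a1|a1] := eqVneq (1 + a ^+ 2) 0.
      apply: Or44; rewrite a1 mulr0 -one_mx2 sl2_class1; split=> //.
      exists a; first by move: ac; rewrite c0 eqxx orbF.
      by apply/eqP; rewrite eq_sym -addr_eq0 addrC a1.
    by apply: Or42; apply/unipotent_classP; exists (e * (1 + a ^+ 2)); rewrite ?mulf_neq0.
  rewrite {}EC prod_rep_class //.
  (* The trace 2 - (e c)^2 differs from 2; it is -2 exactly when (e c)^2 = 4. *)
  have [ec|ec] := eqVneq (e ^+ 2 * c ^+ 2) 4.
    by apply: Or43; rewrite (UmclassE he c0 ec).
  have dR : SL2 (prod_rep e c) by rewrite /SL2 /= det_mx2E; ring.
  have tR : \tr (prod_rep e c) = 2 - e ^+ 2 * c ^+ 2 by rewrite trace_mx2; ring.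
  have tR4 : \tr (prod_rep e c) ^+ 2 != 4.
    rewrite tR -subr_eq0.
    have -> : (2 - e ^+ 2 * c ^+ 2) ^+ 2 - 4
      = e ^+ 2 * c ^+ 2 * (e ^+ 2 * c ^+ 2 - 4) by ring.
    by rewrite !mulf_neq0 ?expf_neq0 // subr_eq0.
  apply: Or41; split.
    exists (prod_rep e c); split=> //; first exact: trace_semisimple.
    by move=> /(central_trace dR) /eqP; apply/negP.
  rewrite (class_trE (is_sl2_class_class dR) (sl2_class_refl _)) tR.
  by exists (e * c); rewrite ?mulf_neq0 //; ring.
case=> [[[M [dM sM nM ->]] [c c0]]|/unipotent_classP[f f0 ->]|->|[-> [a a0 a1]]].
- rewrite (class_trE (is_sl2_class_class dM) (sl2_class_refl _)) => tM.
  have d0 : c / e != 0 by rewrite mulf_neq0 ?invr_eq0.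
  rewrite (@class_prod_rep _ M e (c / e)) //; first exact: prod_rep_sub.
    have -> : e ^+ 2 * (c / e) ^+ 2 = c ^+ 2 by field.
    by rewrite -tM; ring.
  by apply: contra_notN nM => /eqP; apply: semisimple_trace_central.
- have [s [us ss]] := hcard.
  (* Then f = e x^2 (1 + (y / x)^2), and the factor x^2 does not change the class. The ratio y / x
     must be nonzero, since it scales v to w. *)
  have [|x [y [x0 y0 E]]] := sum_nz_squares hu two0 us ss (f := f / e).
    by rewrite mulf_neq0 ?invr_eq0.
  have -> : Uclass f = Uclass (e * (1 + (y / x) ^+ 2)).
    rewrite -(Uclass_sq (e * _) x0); congr Uclass.
    transitivity (e * (x ^+ 2 + y ^+ 2)); last by field.
    by rewrite E; field.
  by apply: upper_sub; rewrite mulf_neq0 ?invr_eq0.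
- rewrite (@UmclassE _ e (2 / e)) //; last by field.
    by apply: prod_rep_sub; rewrite mulf_neq0 ?invr_eq0.
  by rewrite mulf_neq0 ?invr_eq0.
(* Parallel vectors of ratio [a] with a^2 = -1 give inverse factors. *)
- have -> : [set 1] = sl2_class (mx2 1 (e * (1 + a ^+ 2)) 0 1) :> set 'M[k]_2.
    by rewrite -a1 subrr mulr0 -one_mx2 sl2_class1.
  exact: upper_sub.
Qed.
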